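(* Let $R$ and $T$ be two rings and $f:R\to T$ a ring homomorphism. Then $f(P_R)\subseteq P_{f(R)}$. If $f$ is injective, then $f(P_R)=P_{f(R)}$.
   Context: Rings are associative, not necessarily commutative and not necessarily with identity; ring homomorphisms are additive and multiplicative maps. For a ring $R$ and $a\in R$, put $S_R^a=\{b\in R \mid aRb=(0)\}$, where $aRb=(0)$ means $acb=0$ for all $c\in R$. The source of primeness of the ring $R$ is $P_R=\bigcap_{a\in R}S_R^a$. Here $P_{f(R)}$ denotes the source of primeness of the ring $f(R)$ (a subring of $T$), so $P_{f(R)}\subseteq f(R)$. *)

(* Defs.v *)
From HB Require Import structures.
From mathcomp Require Import all_boot ssralg.
From mathcomp Require Import classical_sets.

Set Implicit Arguments.
Unset Strict Implicit.
Unset Printing Implicit Defensive.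

Import GRing.Theory.

Local Open Scope classical_set_scope.
Local Open Scope ring_scope.

(* The ring structures of ssralg all have an identity, so rings without
   identity are built here by joining an additive group with a multiplicative
   semigroup; the product is thus the one of [monoid], written [*] in
   [group_scope]. *)
HB.mixin Record Zmodule_Semigroup_isRng R of GRing.Zmodule R & Semigroup R := {
  rng_mulDl : left_distributive (@mul R) (@GRing.add R);
  rng_mulDr : right_distributive (@mul R) (@GRing.add R)
}.

#[short(type="rngType")]
HB.structure Definition Rng :=
  { R of Zmodule_Semigroup_isRng R & GRing.Zmodule R & Semigroup R }.

HB.structure Definition RngMorphism (R T : rngType) :=
  { f of @GRing.Additive R T f & @Multiplicative R T f }.

Notation "{ 'rngmorphism' R -> T }" := (RngMorphism.type R%type T%type)
  (at level 0, R at level 98, T at level 99,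
   format "{ 'rngmorphism'  R  ->  T }") : type_scope.

(* S_R^a, where aRb = (0) means that acb = 0 for all c in R. *)
Definition prime_ann (R : rngType) (a : R) : set R :=
  [set b | forall c : R, (a * c * b)%g = 0].

Definition prime_source (R : rngType) : set R :=
  \bigcap_(a in [set: R]) prime_ann a.
Arguments prime_source R : clear implicits.

Section ImageRng.
Variables (R T : rngType) (f : {rngmorphism R -> T}).

(* f(R), as a ring of its own; [val : image_rng f -> T] is the inclusion. *)
Definition image_rng : Type := {y : T | y \in range f}.

HB.instance Definition _ := SubChoice.on image_rng.

Fact range_zmod_closed : zmod_closed (fun y : T => y \in range f).
Proof.
split=> [|_ _ /set_mem [x _ <-] /set_mem [y _ <-]]; apply: mem_set.
  by exists 0 => //; rewrite raddf0.
by exists (x - y) => //; rewrite raddfB.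
Qed.

Fact range_mulg_closed : mulg_closed (fun y : T => y \in range f).
Proof.
move=> _ _ /set_mem [x _ <-] /set_mem [y _ <-]; apply: mem_set.
by exists (x * y)%g => //; rewrite gmulfM.
Qed.

HB.instance Definition _ :=
  GRing.SubChoice_isSubZmodule.Build T _ image_rng range_zmod_closed.
HB.instance Definition _ :=
  SubChoice_isSubSemigroup.Build T _ image_rng range_mulg_closed.

Fact image_rng_mulDl : left_distributive (@mul image_rng) (@GRing.add image_rng).
Proof. by move=> x y z; apply: val_inj; rewrite !(gmulfM, raddfD) rng_mulDl. Qed.

Fact image_rng_mulDr : right_distributive (@mul image_rng) (@GRing.add image_rng).
Proof. by move=> x y z; apply: val_inj; rewrite !(gmulfM, raddfD) rng_mulDr. Qed.

HB.instance Definition _ :=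
  Zmodule_Semigroup_isRng.Build image_rng image_rng_mulDl image_rng_mulDr.

End ImageRng.

(* Main.v *)
Require Import Defs.
From HB Require Import structures.
From mathcomp Require Import all_boot ssralg.
From mathcomp Require Import classical_sets.

(** Whether an element [z] of f(R) lies in the source of primeness of f(R) can
    be tested inside [R]: every element of f(R) is some [f a], so the condition
    runs over products [f a * f c * z] with [a], [c] in [R], and if [z = f x]
    such a product is [f (a * c * x)] ([prime_source_image_rngP]).  The first
    inclusion follows because [f] sends 0 to 0; the converse inclusion needs
    that only 0 is sent to 0, which is injectivity. *)

Local Open Scope classical_set_scope.
Local Open Scope ring_scope.

Lemma prime_sourceP {R : rngType} {b : R} :
  prime_source R b <-> forall a c : R, (a * c * b)%g = 0.
Proof. by split=> [Pb a c|Pb a _ c]; [apply: (Pb a) | apply: Pb]. Qed.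

Definition to_image_rng {R T : rngType} (f : {rngmorphism R -> T}) (x : R) :
  image_rng f := exist _ (f x) (mem_set (ex_intro2 _ _ x I erefl)).

Lemma to_image_rng_surj {R T : rngType} {f : {rngmorphism R -> T}}
    (z : image_rng f) :
  exists x, z = to_image_rng f x.
Proof.
by case: (set_mem (valP z)) => x _ fxz; exists x; apply: val_inj; rewrite -fxz.
Qed.

(** The three factors are images under [f], so the product taken in f(R) is
    carried by the inclusion into [T] to the image of the product in [R]. *)
Lemma prime_source_image_rngP {R T : rngType} {f : {rngmorphism R -> T}}
    {x : R} :
  prime_source (image_rng f) (to_image_rng f x) <->
  forall a c : R, f (a * c * x)%g = 0.
Proof.
have valM a c : val (to_image_rng f a * to_image_rng f c * to_image_rng f x)%g
    = f (a * c * x)%g by rewrite !gmulfM.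
split=> [/prime_sourceP Px a c|Px].
  by rewrite -valM Px GRing.raddf0.
apply/prime_sourceP => u v.
have [a ->] := to_image_rng_surj u; have [c ->] := to_image_rng_surj v.
by apply: val_inj; rewrite valM Px GRing.raddf0.
Qed.

Theorem proposition2p21 (R T : rngType) (f : {rngmorphism R -> T}) :
  f @` prime_source R `<=` val @` prime_source (image_rng f) /\
  (injective f ->
   f @` prime_source R = val @` prime_source (image_rng f)).
Proof.
have sub : f @` prime_source R `<=` val @` prime_source (image_rng f).
  move=> _ [x /prime_sourceP Px <-]; exists (to_image_rng f x) => //.
  by apply/prime_source_image_rngP => a c; rewrite Px GRing.raddf0.
split=> // f_inj; apply/seteqP; split=> // _ [z Pz <-].
have [x zx] := to_image_rng_surj z; rewrite {}zx in Pz *.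
exists x => //; apply/prime_sourceP => a c.
by apply: f_inj; rewrite GRing.raddf0; apply/prime_source_image_rngP: a c.
Qed.
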